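(* Let $\mathcal{S}\subseteq 2^{[n]}$ be down-closed (if $S\in\mathcal{S}$ and $S'\subseteq S$ then $S'\in\mathcal{S}$) with $\{j\}\in\mathcal{S}$ for all $j\in[n]$. Then $\mathcal{A}(\mathcal{S})\subseteq\mathcal{B}(\mathcal{S})$. As a consequence, when $\mathcal{S}=2^{[n]}$, strong duality holds for the M-Lagrangian dual, that is, $\mathrm{DUAL}^M=\mathrm{OPT}$.
   Context: $[n]=\{1,\dots,n\}$; $\mathbf{conv}$ denotes convex hull; $\min$ is read as infimum in the extended reals ($+\infty$ over the empty set). Two-block problem. For $i\in\{1,2\}$ let $$\mathcal{X}^{(i)}=\{(x^{(i)},y^{(i)}): A^{(i)}x^{(i)}+B^{(i)}y^{(i)}\le b^{(i)},\ y^{(i)}\ge 0 \text{ mixed-integer},\ x^{(i)}\in\{0,1\}^n\},$$ where ''mixed-integer'' means that a prescribed subset of the coordinates of $y^{(i)}$ is required to be integer, and $A^{(i)},B^{(i)},b^{(i)}$ and the objective vectors $c^{(i)},d^{(i)}$ are rational of suitable dimensions. Let $$\mathrm{OPT}=\min\Big\{\sum_{i\in\{1,2\}}\langle c^{(i)},x^{(i)}\rangle+\langle d^{(i)},y^{(i)}\rangle:\ (x^{(i)},y^{(i)})\in\mathcal{X}^{(i)},\ i\in\{1,2\},\ x^{(1)}=x^{(2)}\Big\}.$$ M-Lagrangian dual. For $\mathcal{S}\subseteq 2^{[n]}$ let $$\mathcal{X}^{(i)}_M(\mathcal{S})=\Big\{(x^{(i)},y^{(i)},w^{(i)}):(x^{(i)},y^{(i)})\in\mathcal{X}^{(i)},\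 w^{(i)}_S=\prod_{j\in S}x^{(i)}_j\ \ \forall S\in\mathcal{S}\Big\}$$ (the empty product is $1$). The value of the M-Lagrangian dual, obtained by dualizing the constraints $w^{(1)}_S=w^{(2)}_S$, $S\in\mathcal{S}$, is given by its primal characterization $$\mathrm{DUAL}^M=\min\Big\{\sum_{i\in\{1,2\}}\langle c^{(i)},x^{(i)}\rangle+\langle d^{(i)},y^{(i)}\rangle:\ (x^{(i)},y^{(i)},w^{(i)})\in\mathbf{conv}\{\mathcal{X}^{(i)}_M(\mathcal{S})\},\ i\in\{1,2\},\ w^{(1)}_S=w^{(2)}_S\ \forall S\in\mathcal{S}\Big\}.$$ Write $(x,y)=(x^{(1)},x^{(2)},y^{(1)},y^{(2)})$, and define $$\mathcal{A}(\mathcal{S})=\{(x,y):\exists w=(w^{(1)},w^{(2)}),\ (x^{(i)},y^{(i)},w^{(i)})\in\mathbf{conv}\{\mathcal{X}^{(i)}_M(\mathcal{S})\}\ \forall i\in\{1,2\},\ w^{(1)}_S=w^{(2)}_S\ \forall S\in\mathcal{S}\},$$ $$\mathcal{B}(\mathcal{S})=\bigcap_{\mathcal{U}\in\mathcal{S}}\mathbf{conv}\{(x,y):(x^{(i)},y^{(i)})\in\mathcal{X}^{(i)}\ \forall i\in\{1,2\},\ x^{(1)}_j=x^{(2)}_j\ \forall j\in\mathcal{U}\}.$$ *)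

(* Defs.v *)
From HB Require Import structures.
From mathcomp Require Import all_boot all_order all_algebra.
From mathcomp Require Import all_classical all_reals ereal.

Set Implicit Arguments.
Unset Strict Implicit.
Unset Printing Implicit Defensive.

Import Order.TTheory GRing.Theory Num.Theory.
Local Open Scope classical_set_scope.
Local Open Scope ring_scope.

Definition conv (R : realType) (V : lmodType R) (A : set V) : set V :=
  [set v | exists (k : nat) (t : 'I_k -> R) (p : 'I_k -> V),
     [/\ forall i, 0 <= t i, \sum_(i < k) t i = 1, forall i, A (p i)
       & v = \sum_(i < k) t i *: p i]].

(* Data of one block; the shared binary vector x has n coordinates, and      *)
(* int_vars is the set of coordinates of y that are required to be integer.  *)
Record block (n : nat) := Block {
  nrows : nat;
  nvars : nat;
  coefx : 'M[rat]_(nrows, n);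
  coefy : 'M[rat]_(nrows, nvars);
  rhs : 'cV[rat]_nrows;
  costx : 'cV[rat]_n;
  costy : 'cV[rat]_nvars;
  int_vars : {set 'I_nvars} }.

Definition ratmx (R : realType) m p (M : 'M[rat]_(m, p)) : 'M[R]_(m, p) :=
  map_mx ratr M.

Definition inner (R : realType) m (u v : 'cV[R]_m) : R :=
  \sum_(j < m) u j ord0 * v j ord0.

(* The space of pairs (x, y). *)
Definition xy (R : realType) n (P : block n) : lmodType R :=
  ('cV[R]_n * 'cV[R]_(nvars P))%type.

(* The space of triples ((x, y), w), with w in R^SS; R^o is R as a module    *)
(* over itself.                                                              *)
Definition xyw (R : realType) n (P : block n) (SS : {set {set 'I_n}}) :
    lmodType R :=
  (xy R P * {ffun {S : {set 'I_n} | S \in SS} -> R^o})%type.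

Definition feasible (R : realType) n (P : block n) : set (xy R P) :=
  [set z | [/\ forall k, (ratmx R (coefx P) *m z.1 +
                          ratmx R (coefy P) *m z.2) k ord0
                         <= ratmx R (rhs P) k ord0,
               forall l, 0 <= z.2 l ord0,
               forall l, l \in int_vars P -> z.2 l ord0 \is a Num.int
             & forall j, z.1 j ord0 = 0 \/ z.1 j ord0 = 1]].
Arguments feasible R {n} P _.

Definition cost (R : realType) n (P : block n) (z : xy R P) : R :=
  inner (ratmx R (costx P)) z.1 + inner (ratmx R (costy P)) z.2.

Definition opt (R : realType) n (P1 P2 : block n) : \bar R :=
  ereal_inf [set (cost z.1 + cost z.2)%:E | z in
    [set z : (xy R P1 * xy R P2)%type |
       [/\ feasible R P1 z.1, feasible R P2 z.2 & z.1.1 = z.2.1]]].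

Definition feasibleM (R : realType) n (P : block n) (SS : {set {set 'I_n}}) :
    set (xyw R P SS) :=
  [set v : xyw R P SS | feasible R P v.1 /\
     forall S : {S : {set 'I_n} | S \in SS},
       v.2 S = \prod_(j in val S) v.1.1 j ord0].
Arguments feasibleM R {n} P SS _.

Definition dual_feasible (R : realType) n (P1 P2 : block n)
    (SS : {set {set 'I_n}}) : set (xyw R P1 SS * xyw R P2 SS) :=
  [set v | [/\ conv (feasibleM R P1 SS) v.1, conv (feasibleM R P2 SS) v.2
             & forall S : {S : {set 'I_n} | S \in SS}, v.1.2 S = v.2.2 S]].
Arguments dual_feasible R {n} P1 P2 SS _.

Definition dualM (R : realType) n (P1 P2 : block n)
    (SS : {set {set 'I_n}}) : \bar R :=
  ereal_inf [set (cost v.1.1 + cost v.2.1)%:E | v in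
    dual_feasible R P1 P2 SS].

(* In setA and setB, the point (x1, x2, y1, y2) is stored blockwise, as      *)
(* ((x1, y1), (x2, y2)).                                                     *)
Definition setA (R : realType) n (P1 P2 : block n) (SS : {set {set 'I_n}}) :
    set (xy R P1 * xy R P2)%type :=
  [set z | exists w1 w2, dual_feasible R P1 P2 SS ((z.1, w1), (z.2, w2))].
Arguments setA R {n} P1 P2 SS _.

Definition setB (R : realType) n (P1 P2 : block n) (SS : {set {set 'I_n}}) :
    set (xy R P1 * xy R P2)%type :=
  \bigcap_(U in [set U : {set 'I_n} | U \in SS])
    conv [set z : (xy R P1 * xy R P2)%type |
      [/\ feasible R P1 z.1, feasible R P2 z.2
        & forall j, j \in U -> z.1.1 j ord0 = z.2.1 j ord0]].
Arguments setB R {n} P1 P2 SS _.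

Definition down_closed n (SS : {set {set 'I_n}}) : Prop :=
  forall S S' : {set 'I_n}, S \in SS -> S' \subset S -> S' \in SS.

(* Main.v *)
(** Fix [U] in [SS], and write the two points of [conv] as convex combinations
    of points of [feasibleM].  Grouping the points of block [i] by the set
    [T = {j in U | x_j = 1}] gives a distribution [mu_i] on subsets of [U], and
    [w^(i)_S] is the sum of the [mu_i T] for [T] containing [S].  Since all
    subsets of [U] are in [SS], Moebius inversion turns [w^(1) = w^(2)] into
    [mu_1 = mu_2].  Coupling the two combinations independently conditionally
    on [T] then exhibits the pair as a convex combination of pairs that agree
    on [U].  For [U = [n]], such pairs are feasible for [opt], and one of them
    costs at most the average. *)
Require Import Defs.
From mathcomp Require Import all_boot all_order all_algebra.
From mathcomp Require Import all_classical all_reals ereal.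

Set Implicit Arguments.
Unset Strict Implicit.
Unset Printing Implicit Defensive.

Import Order.TTheory GRing.Theory Num.Theory.
Local Open Scope classical_set_scope.
Local Open Scope ring_scope.

(** Uniqueness in Moebius inversion, by induction on the size of the complement of [S]: once the
    term [A = S] is isolated, every other term has [A] strictly above [S] and agrees by
    induction. *)
Lemma superset_sum_inj (V : zmodType) (T : finType) (f g : {set T} -> V) :
  (forall S : {set T},
    \sum_(A : {set T} | S \subset A) f A =
    \sum_(A : {set T} | S \subset A) g A) ->
  f =1 g.
Proof.
move=> fg S; have [m] := ubnP #|~: S|.
elim: m S => // m IH S; rewrite ltnS => leSm; move: (fg S).
rewrite (bigD1 S) // [RHS](bigD1 S) //=.
have -> : \sum_(A : {set T} | (S \subset A) && (A != S)) f A =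
          \sum_(A : {set T} | (S \subset A) && (A != S)) g A.
  apply: eq_bigr => A /andP[SA nAS]; apply: IH.
  apply: leq_trans leSm; apply: proper_card.
  by rewrite properC finset.properEneq eq_sym nAS.
exact: addIr.
Qed.

(** Frees [conv] from ordinal indices, so that a combination may run over the pairs of a
    coupling. *)
Lemma conv_fin (R : realType) (V : lmodType R) (X : set V) (I : finType)
    (A : {pred I}) (t : I -> R) (p : I -> V) :
  {in A, forall i, 0 <= t i} -> \sum_(i in A) t i = 1 ->
  {in A, forall i, X (p i)} -> conv X (\sum_(i in A) t i *: p i).
Proof.
move=> t0 t1 Xp.
exists #|A|, (t \o enum_val), (p \o enum_val); split => /=.
- by move=> i; apply: t0; apply: enum_valP.
- by rewrite -big_enum_val.
- by move=> i; apply: Xp; apply: enum_valP.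
- by rewrite big_enum_val.
Qed.

Lemma conv_subset (R : realType) (V : lmodType R) (X : set V) : X `<=` conv X.
Proof.
move=> v Xv; exists 1%N, (fun=> 1), (fun=> v).
by split; rewrite ?big_ord1 ?scale1r.
Qed.

Definition fiber_mass {R : realType} {I : finType} {K : eqType}
  (a : I -> K) (t : I -> R) (u : K) : R := \sum_(i | a i == u) t i.

(** Conditionally independent coupling: the label is drawn first, then [i] and [j] independently
    among the indices with that label. It is meant for pairs with equal labels only. *)
Definition coupling {R : realType} {I J : finType} {K : eqType}
  (a : I -> K) (s : I -> R) (t : J -> R) (ij : I * J) : R :=
  s ij.1 * t ij.2 / fiber_mass a s (a ij.1).

Section Coupling.
Variables (R : realType) (I J : finType) (K : eqType).
Variables (a : I -> K) (b : J -> K) (s : I -> R) (t : J -> R).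
Hypotheses (s0 : forall i, 0 <= s i) (t0 : forall j, 0 <= t j).
Hypothesis mass_eq : fiber_mass a s =1 fiber_mass b t.

Let D := [pred ij : I * J | a ij.1 == b ij.2].

Lemma coupling_ge0 ij : 0 <= coupling a s t ij.
Proof. by rewrite divr_ge0 ?mulr_ge0 ?sumr_ge0. Qed.

Lemma coupling_fst i : \sum_(j | a i == b j) coupling a s t (i, j) = s i.
Proof.
rewrite /coupling /= -mulr_suml -mulr_sumr.
have -> : \sum_(j | a i == b j) t j = fiber_mass a s (a i).
  by rewrite mass_eq; apply: eq_bigl => j; rewrite eq_sym.
have [m0|m_neq0] := eqVneq (fiber_mass a s (a i)) 0; last by rewrite mulfK.
(* Over a label of mass zero the quotient is 0 by convention, and [s i] is 0 too, as a nonnegative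
   term of a zero sum. *)
rewrite m0 mulr0 mul0r; apply/esym/eqP; move/eqP: m0.
by rewrite psumr_eq0 // => /allP/(_ i); rewrite mem_index_enum eqxx => /(_ isT).
Qed.

Lemma coupling_snd j : \sum_(i | a i == b j) coupling a s t (i, j) = t j.
Proof.
have -> : \sum_(i | a i == b j) coupling a s t (i, j) =
          fiber_mass a s (b j) * t j / fiber_mass a s (b j).
  rewrite !mulr_suml; apply: eq_bigr => i /eqP aibj.
  by rewrite /coupling /= aibj.
have [m0|m_neq0] := eqVneq (fiber_mass a s (b j)) 0; last first.
  by rewrite mulrAC divff ?mul1r.
rewrite m0 !mul0r; apply/esym/eqP; move/eqP: m0; rewrite mass_eq.
by rewrite psumr_eq0 // => /allP/(_ j); rewrite mem_index_enum eqxx => /(_ isT).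
Qed.

Lemma coupling_sum_fst (V : lmodType R) (p : I -> V) :
  \sum_(ij in D) coupling a s t ij *: p ij.1 = \sum_i s i *: p i.
Proof.
under [RHS]eq_bigr do rewrite -coupling_fst scaler_suml.
by rewrite pair_big_dep; apply: eq_big => [[i j]|[i j] _].
Qed.

Lemma coupling_sum_snd (V : lmodType R) (q : J -> V) :
  \sum_(ij in D) coupling a s t ij *: q ij.2 = \sum_j t j *: q j.
Proof.
under [RHS]eq_bigr do rewrite -coupling_snd scaler_suml.
rewrite (exchange_big_dep predT) //= pair_big_dep.
by apply: eq_big => [[i j]|[i j] _].
Qed.

(** The coupling has marginals [s] and [t], so both sums become sums over the same pairs, and these
    have equal labels. *)
Lemma conv_coupling (V W : lmodType R) (p : I -> V) (q : J -> W)
    (X : set (V * W)%type) :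
  \sum_i s i = 1 -> (forall i j, a i = b j -> X (p i, q j)) ->
  conv X (\sum_i s i *: p i, \sum_j t j *: q j).
Proof.
move=> s1 Xpq; rewrite -coupling_sum_fst -coupling_sum_snd.
have -> : (\sum_(ij in D) coupling a s t ij *: p ij.1,
           \sum_(ij in D) coupling a s t ij *: q ij.2) =
          \sum_(ij in D) coupling a s t ij *: (p ij.1, q ij.2) :> (V * W)%type.
  by rewrite [RHS]surjective_pairing !raddf_sum.
apply: conv_fin => [ij _||[i j] /eqP]; first exact: coupling_ge0.
  (* The total mass is 1: the first marginal is tested against the constant 1. *)
  have := coupling_sum_fst (V := R^o) (fun=> 1).
  by rewrite -!scaler_suml s1 scale1r => E; rewrite -[LHS]mulr1; apply: E.
exact: Xpq.
Qed.

End Coupling.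

Definition ones {R : realType} {n} (U : {set 'I_n}) (x : 'cV[R]_n) :
  {set 'I_n} := [set j in U | x j ord0 == 1]%SET.

Lemma binary_prod (R : realType) n (U S : {set 'I_n}) (x : 'cV[R]_n) :
  (forall j, x j ord0 = 0 \/ x j ord0 = 1) -> S \subset U ->
  \prod_(j in S) x j ord0 = (S \subset ones U x)%:R.
Proof.
move=> xbin /fintype.subsetP SU.
case: (boolP (S \subset _)) => [/fintype.subsetP Sx|].
  by apply: big1 => j /Sx; rewrite inE => /andP[_ /eqP].
case/fintype.subsetPn => j Sj; rewrite inE SU //= => xj.
rewrite (bigD1 j) //=; case: (xbin j) xj => -> //; last by rewrite eqxx.
by rewrite mul0r.
Qed.

(** Each index [i] is counted exactly once, at [A = a i]. *)
Lemma superset_fiber_mass (R : realType) (I T : finType) (a : I -> {set T})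
    (t : I -> R) (S : {set T}) :
  \sum_(A : {set T} | S \subset A) fiber_mass a t A =
  \sum_(i | S \subset a i) t i.
Proof.
rewrite (exchange_big_dep (fun i => S \subset a i)) /=; last first.
  by move=> A i SA /eqP->.
apply: eq_bigr => i Sai; rewrite (bigD1 (a i)) ?Sai ?eqxx //=.
rewrite big1 ?addr0 // => A /andP[/andP[_ /eqP->]].
by rewrite eqxx.
Qed.

(** At a binary point the monomial of [S] is the indicator that the label contains [S], so its
    average is the mass of such labels. *)
Lemma moment_ones (R : realType) n (P : block n) (SS : {set {set 'I_n}})
    (I : finType) (t : I -> R) (p : I -> xyw R P SS) (U : {set 'I_n})
    (S : {S : {set 'I_n} | S \in SS}) :
  (forall i, feasibleM R P SS (p i)) -> val S \subset U ->
  (\sum_i t i *: p i).2 S =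
  \sum_(i | val S \subset ones U (p i).1.1) t i.
Proof.
move=> fp SU; rewrite raddf_sum sum_ffunE [RHS]big_mkcond /=.
apply: eq_bigr => i _; rewrite ffunE; have [[_ _ _ xbin] ->] := fp i.
rewrite (binary_prod xbin SU).
by case: ifP => _; [exact: mulr1 | exact: mulr0].
Qed.

Lemma setA_subset_setB (R : realType) (n : nat) (P1 P2 : block n)
    (SS : {set {set 'I_n}}) :
  down_closed SS -> setA R P1 P2 SS `<=` setB R P1 P2 SS.
Proof.
move=> SS_down [z1 z2] [w1 [w2 [/= C1 C2 w12]]] U /= US.
case: C1 w12 => k1 [t1 [p1 [t1_ge0 t1_sum fp1 e1]]].
case: C2 => k2 [t2 [p2 [t2_ge0 t2_sum fp2 e2]]] w12.
have -> : z1 = \sum_i t1 i *: (p1 i).1.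
  by have := congr1 fst e1; rewrite raddf_sum.
have -> : z2 = \sum_i t2 i *: (p2 i).1.
  by have := congr1 fst e2; rewrite raddf_sum.
apply: (@conv_coupling _ _ _ _ (fun i => ones U (p1 i).1.1)
  (fun i => ones U (p2 i).1.1)) => //.
  apply: superset_sum_inj => S; rewrite !superset_fiber_mass.
  (* Labels lie inside [U], so both sums are empty unless [S] does too; then [S] is in [SS] by
     down-closure and [w12] applies. *)
  have [SU|nSU] := boolP (S \subset U); last first.
    have sub0 (x : 'cV[R]_n) : (S \subset ones U x) = false.
      apply: contraNF nSU => /fintype.subset_trans; apply.
      by apply/fintype.subsetP => j; rewrite inE => /andP[].
    by rewrite !big1 // => i; rewrite sub0.
  have S_SS : S \in SS by apply: SS_down SU.
  pose T : {S : {set 'I_n} | S \in SS} := exist _ S S_SS.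
  have TU : val T \subset U by [].
  have := w12 T; rewrite (congr1 snd e1 : w1 = _) (congr1 snd e2 : w2 = _).
  by rewrite (moment_ones t1 fp1 TU) (moment_ones t2 fp2 TU).
(* Equal labels give the same ones on [U]; the remaining entries there are 0 on both sides, since
   the points are binary. *)
move=> i j /setP eq_ones; have [[[A1 B1 C1 D1] _] [f2 _]] := (fp1 i, fp2 j).
split=> // l lU; have := eq_ones l; rewrite !inE lU /=.
have [_ _ _ D2] := f2.
by case: (D1 l) (D2 l) => -> [] -> //; rewrite eqxx [_ == _]eq_sym oner_eq0.
Qed.

Lemma inner_sumr (R : realType) m (I : finType) (c : 'cV[R]_m) (t : I -> R)
    (u : I -> 'cV[R]_m) :
  inner c (\sum_i t i *: u i) = \sum_i t i * inner c (u i).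
Proof.
under [RHS]eq_bigr do rewrite mulr_sumr.
rewrite exchange_big; apply: eq_bigr => j _.
by rewrite summxE mulr_sumr; apply: eq_bigr => i _; rewrite mxE mulrCA.
Qed.

Lemma cost_sum (R : realType) n (P : block n) (I : finType) (t : I -> R)
    (p : I -> xy R P) :
  cost (\sum_i t i *: p i) = \sum_i t i * cost (p i).
Proof.
rewrite /cost !raddf_sum !inner_sumr -big_split /=.
by apply: eq_bigr => i _; rewrite mulrDr.
Qed.

(** Otherwise all gaps [f i - m] are positive, yet their weighted sum is 0, which forces every
    weight to vanish. *)
Lemma exists_le_average (R : realType) (I : finType) (t f : I -> R) :
  (forall i, 0 <= t i) -> \sum_i t i = 1 ->
  exists i, f i <= \sum_j t j * f j.
Proof.
move=> t0 t1; set m := \sum_j _; apply: contrapT => /forallNP lt_m.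
have : \sum_j t j * (f j - m) = 0.
  under eq_bigr do rewrite mulrBr.
  by rewrite sumrB -mulr_suml t1 mul1r subrr.
move=> /eqP; rewrite psumr_eq0 => [/allP tf0|j _]; last first.
  by rewrite mulr_ge0 // subr_ge0 ltW // ltNge; apply/negP.
suff: \sum_i t i = 0 by rewrite t1 => /eqP; rewrite oner_eq0.
apply: big1 => i _; have /= := tf0 i (mem_index_enum i).
rewrite mulf_eq0 subr_eq0 => /orP[/eqP //|/eqP fim].
by case: (lt_m i); rewrite fim.
Qed.

Lemma feasibleM_lift (R : realType) n (P : block n) (SS : {set {set 'I_n}})
    (z : xy R P) :
  feasible R P z ->
  feasibleM R P SS
    (z, [ffun S : {S : {set 'I_n} | S \in SS} =>
           \prod_(j in val S) z.1 j ord0]).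
Proof. by move=> fz; split => // S; rewrite ffunE. Qed.

(** Weak duality, for any [SS]: adjoining the monomials to a feasible pair keeps its cost. *)
Lemma dualM_le_opt (R : realType) n (P1 P2 : block n) (SS : {set {set 'I_n}}) :
  (dualM R P1 P2 SS <= opt R P1 P2)%E.
Proof.
apply: le_ereal_inf => _ [[z1 z2] /= [f1 f2 x12] <-].
exists ((z1, [ffun S : {S : {set 'I_n} | S \in SS} =>
                \prod_(j in val S) z1.1 j ord0]),
        (z2, [ffun S : {S : {set 'I_n} | S \in SS} =>
                \prod_(j in val S) z2.1 j ord0])) => //.
split; [| |by move=> S; rewrite !ffunE x12];
  by apply: conv_subset; apply: feasibleM_lift.
Qed.

Lemma opt_le_dualM (R : realType) n (P1 P2 : block n) :
  (opt R P1 P2 <= dualM R P1 P2 [set: {set 'I_n}]%SET)%E.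
Proof.
apply: le_ereal_inf_tmp => _ [[[z1 w1] [z2 w2]] /= dv <-].
have : setB R P1 P2 [set: {set 'I_n}]%SET (z1, z2).
  by apply: setA_subset_setB => [S S' _ _|]; [rewrite inE | exists w1, w2].
(* For this [U] the generating pairs agree in all coordinates of [x], hence are feasible for [opt].
   The cost is linear, so one of them costs at most the dual point. *)
move=> /(_ [set: 'I_n]%SET (finset.in_setT _)) [k [t [p [t0 t1 fp zE]]]].
have -> : z1 = \sum_i t i *: (p i).1.
  by have := congr1 fst zE; rewrite raddf_sum.
have -> : z2 = \sum_i t i *: (p i).2.
  by have := congr1 snd zE; rewrite raddf_sum.
have [i le_i] := exists_le_average (fun i => cost (p i).1 + cost (p i).2) t0 t1.
rewrite !cost_sum -big_split /=; under eq_bigr do rewrite -mulrDr.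
apply: le_trans (_ : ((cost (p i).1 + cost (p i).2)%:E <= _)%E).
  apply: ereal_inf_lbound; exists (p i) => //.
  have [f1 f2 x12] := fp i; split=> //.
  by apply/colP => j; apply: x12; rewrite inE.
by rewrite lee_fin.
Qed.

Theorem theorem2 (R : realType) (n : nat) (P1 P2 : block n)
    (SS : {set {set 'I_n}})
    (SS_down : down_closed SS)
    (SS_singl : forall j : 'I_n, [set j]%SET \in SS) :
  setA R P1 P2 SS `<=` setB R P1 P2 SS /\
  (SS = [set: {set 'I_n}]%SET -> dualM R P1 P2 SS = opt R P1 P2).
Proof.
split=> [|->]; first exact: setA_subset_setB.
by apply/eqP; rewrite eq_le dualM_le_opt opt_le_dualM.
Qed.
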